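(* Let $F:\mathbb{R}^n\to\mathbb{R}^n$ be continuous. Assume that $\theta(t)\geq\frac{t}{t+1}$ for all $t\geq 0$. Let $x^*$ be a solution of the nonlinear complementarity problem, i.e. $x^*\geq 0$, $F(x^* )\geq 0$ and $\langle x^*,F(x^* )\rangle=0$. For $r>0$ let $x^{(r)}$ denote a nonnegative solution (when one exists) of $H_r(x)=0$, where $H_r(x)=\big(G_r(x_i,F_i(x))\big)_{i=1}^n$. (i) For every $r>0$ and every such $x^{(r)}$, one has $x_i^{(r)}F_i(x^{(r)})\leq r^2$ for all $i=1,\dots,n$. (ii) Suppose that $F$ satisfies $$h(\|x-y\|)\leq\langle x-y,F(x)-F(y)\rangle\qquad\text{for all }x,y\in\mathbb{R}^n,$$ where $h:\mathbb{R}^+\to\mathbb{R}$ satisfies $h(0)=0$ and there exist $\varepsilon>0$ and $\eta>0$ such that $h$ restricts to an increasing bijection $h:[0,\varepsilon)\to[0,\eta)$. Then there exists $r_0>0$ such that for every $r\in(0,r_0)$ and every such $x^{(r)}$, $$\|x^*-x^{(r)}\|\leq h^{-1}(n r^2),$$ where $h^{-1}:[0,\eta)\to[0,\varepsilon)$ is the inverse of this bijection.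
   Context: Vector inequalities are componentwise; $\langle\cdot,\cdot\rangle$ is the standard inner product on $\mathbb{R}^n$ and $\|\cdot\|$ the Euclidean norm; $\mathbb{R}^+=[0,+\infty)$. $\theta:\mathbb{R}\to(-\infty,1)$ is a (strictly) increasing continuous function, onto $(-\infty,1)$, with $\theta(t)<0$ for $t<0$, $\theta(0)=0$ and $\lim_{t\to+\infty}\theta(t)=1$. Put $\psi=1-\theta$, a decreasing bijection from $\mathbb{R}$ onto $(0,+\infty)$ with inverse $\psi^{-1}$. For $r>0$ and $s,t\in\mathbb{R}$, $$G_r(s,t):=r\,\psi^{-1}\!\left[\psi\!\left(\tfrac{s}{r}\right)+\psi\!\left(\tfrac{t}{r}\right)\right].$$ *)

(* Defs.v *)
From HB Require Import structures.
From mathcomp Require Import all_boot all_order all_algebra.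
From mathcomp Require Import all_classical all_reals all_analysis.

Set Implicit Arguments.
Unset Strict Implicit.
Unset Printing Implicit Defensive.

Import Order.TTheory GRing.Theory Num.Theory.
Import numFieldNormedType.Exports.

Local Open Scope classical_set_scope.
Local Open Scope ring_scope.

(* The library norm on matrices is the sup norm, so the Euclidean inner product
   and norm on 'rV[R]_n are introduced here. The topology on 'rV[R]_n used for
   continuity is the library one (the product topology). *)
Definition inner (R : realType) (n : nat) (x y : 'rV[R]_n) : R :=
  \sum_(i < n) x 0 i * y 0 i.

Definition enorm (R : realType) (n : nat) (x : 'rV[R]_n) : R :=
  Num.sqrt (inner x x).

Definition nonneg (R : realType) (n : nat) (x : 'rV[R]_n) : Prop :=
  forall i : 'I_n, 0 <= x 0 i.

Definition ncp_solution (R : realType) (n : nat)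
    (F : 'rV[R]_n -> 'rV[R]_n) (x : 'rV[R]_n) : Prop :=
  [/\ nonneg x, nonneg (F x) & inner x (F x) = 0].

Definition smoothing_fun (R : realType) (theta : R -> R) : Prop :=
  [/\ {homo theta : s t / s < t},
      continuous theta,
      range theta = [set y | y < 1],
      (forall t : R, t < 0 -> theta t < 0) /\ theta 0 = 0
    & theta t @[t --> +oo] --> (1 : R)].

Definition psi (R : realType) (theta : R -> R) (t : R) : R := 1 - theta t.

(* Inverse of psi : R -> (0, +oo); the default value 0 is only taken outside
   the range of psi, i.e. at nonpositive arguments, where it is never used. *)
Definition psi_inv (R : realType) (theta : R -> R) : R -> R :=
  'pinv_(fun=> 0) setT (psi theta).

Definition G (R : realType) (theta : R -> R) (r s t : R) : R :=
  r * psi_inv theta (psi theta (s / r) + psi theta (t / r)).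

Definition H (R : realType) (n : nat) (theta : R -> R)
    (F : 'rV[R]_n -> 'rV[R]_n) (r : R) (x : 'rV[R]_n) : 'rV[R]_n :=
  \row_(i < n) G theta r (x 0 i) (F x 0 i).

Definition smoothed_solution (R : realType) (n : nat) (theta : R -> R)
    (F : 'rV[R]_n -> 'rV[R]_n) (r : R) (x : 'rV[R]_n) : Prop :=
  nonneg x /\ H theta F r x = 0.

(* h : [0, +oo) -> R is represented by a total function of which only the
   values at nonnegative arguments matter. *)
Definition increasing_bij (R : realType) (eps eta : R) (h : R -> R) : Prop :=
  {in `[0, eps[ &, {homo h : s t / s < t}} /\ set_bij `[0, eps[ `[0, eta[ h.

(* Inverse [0, eta) -> [0, eps) of such an h; its values outside [0, eta) are
   meaningless. *)
Definition local_inv (R : realType) (eps : R) (h : R -> R) : R -> R :=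
  'pinv_(fun=> 0) `[0, eps[ h.

(* Main.v *)
(* A zero of G_r(s, t) satisfies theta(s/r) + theta(t/r) = 1, so s, t > 0, and
   then theta(u) >= u/(u+1) forces st <= r^2. Writing z for the solution xstar
   and summing over the coordinates, <z - x, F(z) - F(x)> <= n r^2, hence
   h(|z - x|) <= n r^2. Since h is only controlled on [0, eps), one must also
   exclude |z - x| >= eps: splitting the segment [x, z] into N equal pieces of
   length in [eps/2, eps) and adding up the N local inequalities gives
   <z - x, F(z) - F(x)> >= h(eps/2). *)

Require Import Defs.
From HB Require Import structures.
From mathcomp Require Import all_boot all_order all_algebra.
From mathcomp Require Import all_classical all_reals all_analysis.
From mathcomp Require Import ring lra.

Import Order.TTheory GRing.Theory Num.Theory.
Import numFieldNormedType.Exports.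

Local Open Scope classical_set_scope.
Local Open Scope ring_scope.

Lemma smoothing_fun_lt1 (R : realType) (theta : R -> R) (t : R) :
  smoothing_fun theta -> theta t < 1.
Proof.
move=> [_ _ theta_range _ _].
have : range theta (theta t) by exists t.
by rewrite theta_range.
Qed.

(** A sum of two values of [psi] is positive, hence again a value of [psi], so [psi_inv] is a
    genuine inverse there and its default is not taken. Applying [psi] to the zero, with
    [psi theta 0 = 1], gives the identity. *)
Lemma G_eq0 (R : realType) (theta : R -> R) (r s t : R) :
  smoothing_fun theta -> 0 < r -> G theta r s t = 0 ->
  theta (s / r) + theta (t / r) = 1.
Proof.
move=> theta_s r_gt0 /eqP; have [_ _ theta_range [_ theta0] _] := theta_s.
have theta_lt1 := fun u => smoothing_fun_lt1 _ _ u theta_s.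
rewrite /G mulf_eq0 gt_eqF //= => /eqP inv0.
have in_range : psi theta (s / r) + psi theta (t / r) \in range (psi theta).
  have : range theta (1 - (psi theta (s / r) + psi theta (t / r))).
    rewrite theta_range /= /psi.
    by have := theta_lt1 (s / r); have := theta_lt1 (t / r); lra.
  move=> [u _ theta_u]; apply/mem_set; exists u => //.
  by rewrite [psi theta u]/psi theta_u; lra.
have := pinvK (fun=> 0) in_range.
by rewrite -/(psi_inv theta) inv0 /psi theta0; lra.
Qed.

(** Two numbers below 1 with sum 1 are both positive, and [theta] is positive only at positive
    arguments. *)
Lemma G_eq0_gt0 (R : realType) (theta : R -> R) (r s t : R) :
  smoothing_fun theta -> 0 < r -> G theta r s t = 0 -> 0 < s /\ 0 < t.
Proof.
move=> theta_s r_gt0 /(G_eq0 _ _ _ _ _ theta_s r_gt0) sum1.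
have [_ _ _ [theta_lt0 theta0] _] := theta_s.
have theta_lt1 := fun u => smoothing_fun_lt1 _ _ u theta_s.
have theta_pos u : 0 < theta (u / r) -> 0 < u.
  rewrite -[0 < u](pmulr_lgt0 _ (_ : 0 < r^-1)) ?invr_gt0 //.
  case: (ltgtP 0 (u / r)) => // [/theta_lt0|<-]; rewrite ?theta0 ?ltxx //.
  by move=> /lt_trans H /H; rewrite ltxx.
by split; apply: theta_pos;
  have := theta_lt1 (s / r); have := theta_lt1 (t / r); lra.
Qed.

Lemma G_eq0_mul_le (R : realType) (theta : R -> R) (r s t : R) :
  smoothing_fun theta -> (forall u, 0 <= u -> u / (u + 1) <= theta u) ->
  0 < r -> G theta r s t = 0 -> s * t <= r ^+ 2.
Proof.
move=> theta_s theta_ge r_gt0 G0.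
have [s_gt0 t_gt0] := G_eq0_gt0 _ _ _ _ _ theta_s r_gt0 G0.
have sum1 := G_eq0 _ _ _ _ _ theta_s r_gt0 G0.
have sr_gt0 : 0 < s / r by rewrite divr_gt0.
have tr_gt0 : 0 < t / r by rewrite divr_gt0.
have sr_ge := theta_ge _ (ltW sr_gt0); have tr_ge := theta_ge _ (ltW tr_gt0).
have -> : s * t = (s / r) * (t / r) * r ^+ 2 by field; rewrite gt_eqF.
rewrite ler_piMl ?sqr_ge0 //.
move: (s / r) (t / r) sr_gt0 tr_gt0 sr_ge tr_ge sum1 => a b a_gt0 b_gt0 ha hb e.
have : a / (a + 1) + b / (b + 1) <= 1 by lra.
(* Clearing denominators turns the bound into 2ab + a + b <= ab + a + b + 1, that is, ab <= 1. *)
rewrite addf_div ?gt_eqF ?ler_pdivrMr ?mulr_gt0 ?addr_gt0 //.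
nra.
Qed.

Section Inner.
Context {R : realType} {n : nat}.
Implicit Types (x y z : 'rV[R]_n) (a : R).

Lemma innerC x y : inner x y = inner y x.
Proof. by apply: eq_bigr => i _; rewrite mulrC. Qed.

Lemma innerDr x y z : inner x (y + z) = inner x y + inner x z.
Proof. by rewrite -big_split; apply: eq_bigr => i _; rewrite mxE mulrDr. Qed.

Lemma innerNr x y : inner x (- y) = - inner x y.
Proof. by rewrite -sumrN; apply: eq_bigr => i _; rewrite mxE mulrN. Qed.

Lemma innerZl a x y : inner (a *: x) y = a * inner x y.
Proof. by rewrite mulr_sumr; apply: eq_bigr => i _; rewrite mxE mulrA. Qed.

Lemma inner_ge0 x y : nonneg x -> nonneg y -> 0 <= inner x y.
Proof. by move=> x_ge0 y_ge0; apply: sumr_ge0 => i _; apply: mulr_ge0. Qed.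

Lemma enorm_ge0 x : 0 <= enorm x.
Proof. exact: sqrtr_ge0. Qed.

Lemma enormZ a x : 0 <= a -> enorm (a *: x) = a * enorm x.
Proof.
move=> a_ge0; rewrite /enorm innerZl innerC innerZl mulrA -expr2.
by rewrite sqrtrM ?sqr_ge0 // sqrtr_sqr ger0_norm.
Qed.

End Inner.

Section LocalMonotonicity.
Context {R : realType} {n : nat}.
Variables (F : 'rV[R]_n -> 'rV[R]_n) (h : R -> R).
Hypothesis F_mono :
  forall x y, h (enorm (x - y)) <= inner (x - y) (F x - F y).

(** Consecutive points of the chain y, y + u, ..., y + ku differ by exactly u, so each step
    contributes at least [h (enorm u)] and the increments of F telescope. *)
Lemma inner_chain_ge (u y : 'rV[R]_n) (k : nat) :
  k%:R * h (enorm u) <= inner u (F (y + k%:R *: u) - F y).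
Proof.
elim: k => [|k IHk].
  by rewrite mul0r scale0r addr0 innerDr innerNr subrr.
have := F_mono (y + k.+1%:R *: u) (y + k%:R *: u).
have -> : y + k.+1%:R *: u - (y + k%:R *: u) = u.
  by rewrite opprD addrACA subrr add0r -scalerBl -natrB // subSnn scale1r.
move: IHk; rewrite !innerDr !innerNr -natr1 mulrDl mul1r.
lra.
Qed.

Lemma inner_far_ge (eps eta : R) (x y : 'rV[R]_n) :
  0 < eps -> increasing_bij eps eta h -> eps <= enorm (x - y) ->
  h (eps / 2) <= inner (x - y) (F x - F y).
Proof.
move=> eps_gt0 [h_incr [h_img _ _]]; set d := enorm (x - y) => d_ge.
(* The successor makes d / N < eps strictly; since d >= eps, also N <= d / eps + 1 <= 2d / eps, so d
   / N >= eps / 2. *)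
pose N := (Num.truncn (d / eps)).+1.
have N_gt0 : 0 < N%:R :> R by rewrite ltr0n.
have d_ge0 : 0 <= d / eps by rewrite divr_ge0 ?enorm_ge0 ?ltW.
have /andP[le_trunc lt_trunc] := truncn_itv d_ge0.
have step_lt : d < N%:R * eps by rewrite -ltr_pdivrMr.
have step_ge : N%:R * (eps / 2) <= d.
  have : 1 <= d / eps by rewrite ler_pdivlMr // mul1r.
  rewrite mulrCA -ler_pdivlMl // [_^-1 * _]mulrC.
  by move: le_trunc; rewrite /N -(natr1 (Num.truncn _)); lra.
pose u := N%:R^-1 *: (x - y).
have xyE : x - y = N%:R *: u by rewrite scalerA divff ?scale1r ?gt_eqF.
have u_norm : enorm u = d / N%:R by rewrite enormZ ?invr_ge0 ?ltW // mulrC.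
have half_in : eps / 2 \in `[0, eps[ by rewrite in_itv /=; lra.
have u_ge : eps / 2 <= enorm u by rewrite u_norm ler_pdivlMr // mulrC.
have u_in : enorm u \in `[0, eps[.
  by rewrite in_itv /= enorm_ge0 u_norm ltr_pdivrMr // mulrC.
have h_half_ge0 : 0 <= h (eps / 2).
  by have /= := h_img (eps / 2) half_in; rewrite in_itv => /andP[].
have h_u_ge : h (eps / 2) <= h (enorm u).
  by case: ltgtP u_ge => // [lt_u|->] _ //; apply/ltW/h_incr.
clearbody u; have := inner_chain_ge u y N; rewrite -xyE [y + _]addrC subrK [in inner (x - y)]xyE innerZl.
have N_ge1 : 1 <= N%:R :> R by rewrite ler1n.
have h_u_ge0 := le_trans h_half_ge0 h_u_ge.
move=> /(le_trans (ler_peMl h_u_ge0 N_ge1)) inner_ge.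
apply: le_trans (le_trans h_u_ge inner_ge) _.
by rewrite ler_peMl // (le_trans h_u_ge0).
Qed.

End LocalMonotonicity.

Theorem proposition3p1 (R : realType) (n : nat) (theta : R -> R)
    (F : 'rV[R]_n -> 'rV[R]_n) (xstar : 'rV[R]_n)
    (theta_smoothing : smoothing_fun theta)
    (F_cont : continuous F)
    (theta_ge : forall t : R, 0 <= t -> t / (t + 1) <= theta t)
    (xstar_sol : ncp_solution F xstar) :
  (forall (r : R) (x : 'rV[R]_n), 0 < r -> smoothed_solution theta F r x ->
     forall i : 'I_n, x 0 i * F x 0 i <= r ^+ 2)
  /\
  (forall (h : R -> R) (eps eta : R),
     (forall x y : 'rV[R]_n, h (enorm (x - y)) <= inner (x - y) (F x - F y)) ->
     h 0 = 0 -> 0 < eps -> 0 < eta -> increasing_bij eps eta h ->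
     exists2 r0 : R, 0 < r0 &
       forall r : R, 0 < r -> r < r0 ->
         (* so that the inverse of h is meaningful at this point *)
         n%:R * r ^+ 2 < eta /\
         forall x : 'rV[R]_n, smoothed_solution theta F r x ->
           enorm (xstar - x) <= local_inv eps h (n%:R * r ^+ 2)).
Proof.
have sol_G r x i : smoothed_solution theta F r x ->
    G theta r (x 0 i) (F x 0 i) = 0.
  by move=> [_ /rowP/(_ i)]; rewrite !mxE.
have prod_le r x : 0 < r -> smoothed_solution theta F r x ->
    forall i, x 0 i * F x 0 i <= r ^+ 2.
  by move=> r_gt0 x_sol i; apply: (G_eq0_mul_le _ theta) => //; apply: sol_G.
split=> // h eps eta F_mono h0 eps_gt0 eta_gt0 h_bij.
have inner_le r x : 0 < r -> smoothed_solution theta F r x ->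
    inner (xstar - x) (F xstar - F x) <= n%:R * r ^+ 2.
  move=> r_gt0 x_sol; have [xs_ge0 Fxs_ge0 xs_orth] := xstar_sol.
  (* Nonnegativity of F x is not part of [smoothed_solution]; it follows from the vanishing of G. *)
  have Fx_ge0 : nonneg (F x).
    by move=> i; have /G_eq0_gt0[] := sol_G _ _ i x_sol => // _ /ltW.
  have : inner x (F x) <= n%:R * r ^+ 2.
    rewrite -[n in n%:R]card_ord mulr_natl -sumr_const.
    by apply: ler_sum => i _; apply: prod_le.
  (* In the expanded product the term in [xstar] alone vanishes and both cross terms are
     nonpositive, leaving only [inner x (F x)]. *)
  have := inner_ge0 _ _ xs_ge0 Fx_ge0; have := inner_ge0 _ _ x_sol.1 Fxs_ge0.
  rewrite [inner (_ - x) _]innerC innerDr innerNr ![inner (F xstar - _) _]innerC.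
  rewrite !innerDr !innerNr xs_orth; lra.
have [h_incr h_set_bij] := h_bij; have [h_img _ h_surj] := h_set_bij.
have half_in : eps / 2 \in `[0, eps[ by rewrite in_itv /=; lra.
have zero_in : 0 \in `[0, eps[ by rewrite in_itv /= lexx.
have h_half_gt0 : 0 < h (eps / 2) by rewrite -h0; apply: h_incr => //; lra.
have h_half_lt : h (eps / 2) < eta.
  by have /= := h_img (eps / 2) half_in; rewrite in_itv => /andP[].
(* Below 1 one has r^2 <= r, so the second bound gives n r^2 < h(eps/2); [n.+1] avoids dividing by
   zero when n = 0. *)
pose r0 := Num.min 1 (h (eps / 2) / n.+1%:R).
exists r0; first by rewrite /r0 lt_min ltr01 divr_gt0.
move=> r r_gt0; rewrite lt_min => /andP[r_lt1 r_lt].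
have nr2_lt : n%:R * r ^+ 2 < h (eps / 2).
  move: r_lt; rewrite ltr_pdivlMr // -natr1.
  have : 0 <= n%:R :> R by [].
  nra.
have nr2_in : n%:R * r ^+ 2 \in `[0, eta[.
  by rewrite in_itv /= mulr_ge0 ?sqr_ge0 //= (lt_trans nr2_lt).
split=> [|x x_sol]; first exact: lt_trans nr2_lt _.
have xs_le := inner_le _ _ r_gt0 x_sol.
have near_x : enorm (xstar - x) < eps.
  rewrite ltNge; apply/negP => /(inner_far_ge _ _ F_mono _ _ _ _ eps_gt0 h_bij).
  lra.
have inv_in : local_inv eps h (n%:R * r ^+ 2) \in `[0, eps[.
  by have [+ _ _] := bijpinv_bij (fun=> 0) h_set_bij; apply.
have inv_K : h (local_inv eps h (n%:R * r ^+ 2)) = n%:R * r ^+ 2.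
  by apply: (surjpK (fun=> 0) h_surj); rewrite mem_setE.
have norm_in : enorm (xstar - x) \in `[0, eps[.
  by rewrite in_itv /= enorm_ge0.
(* Otherwise strict monotonicity of h would give n r^2 < h(|xstar - x|), while [F_mono] and [xs_le]
   bound the latter by n r^2. *)
rewrite leNgt; apply/negP => /(h_incr _ _ inv_in norm_in).
by rewrite inv_K; have := F_mono xstar x; lra.
Qed.
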